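(* Let $A\in\mathbb{R}^{n\times n}$ have real eigenvalues $\lambda_1\le\lambda_2\le\cdots\le\lambda_\ell<\lambda_{\ell+1}\le\cdots\le\lambda_n$ (for some $1\le \ell<n$) with corresponding eigenvectors $\phi_1,\ldots,\phi_n\in\mathbb{R}^n$, $A\phi_j=\lambda_j\phi_j$, satisfying $\phi_i^T\phi_j=\delta_{ij}$. Let $\theta\in(0,1)$ and choose the shift $$\tau_k=\frac{\lambda_{\ell+1}+\lambda_n}{2}-\frac{1}{\theta}-1 .$$ Then the convergence rate $\mathrm{Rate}_{k+1}$ of the Richardson iteration step for the shift-inverse equation, defined by $$\mathrm{Rate}_{k+1}:=\frac{\max_{\lambda_j\ge\lambda_{\ell+1}}\big|1+\theta(1+\tau_k)-\theta\lambda_j\big|}{\min_{\lambda_j\le\lambda_\ell}\big|1+\theta(1+\tau_k)-\theta\lambda_j\big|},$$ satisfies $$\mathrm{Rate}_{k+1}=\frac{\lambda_n-\lambda_{\ell+1}}{\lambda_n+\lambda_{\ell+1}-2\lambda_\ell}=1-2\,\frac{\lambda_{\ell+1}-\lambda_\ell}{\lambda_n+\lambda_{\ell+1}-2\lambda_\ell}.$$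
   Context: The eigenvalue problem is to find $(\lambda,x)\in\mathbb{R}\times\mathbb{R}^n$ with $Ax=\lambda x$; the desired eigenvalues are $\lambda_1,\ldots,\lambda_\ell$ and the undesired ones are $\lambda_{\ell+1},\ldots,\lambda_n$. The shift-inverse method with shift $\tau_k$ requires solving $(A-\tau_k I)\tilde{x}_i^{(k)}=x_i^{(k)}$ for given approximate eigenvectors $x_i^{(k)}$, $i=1,\ldots,\ell$. The Richardson iteration step for this equation, with parameter $\theta\in(0,1)$, is $$x_i^{(k+1)}=x_i^{(k)}-\theta\big((A-\tau_kI)x_i^{(k)}-x_i^{(k)}\big)=\Big(\big(1+\theta(1+\tau_k)\big)I-\theta A\Big)x_i^{(k)}.$$ Writing $x_i^{(k)}=\sum_{j=1}^n\alpha_{ij}^{(k)}\phi_j$, the coefficients evolve by $\alpha_{ij}^{(k+1)}=\big(1+\theta(1+\tau_k)-\theta\lambda_j\big)\alpha_{ij}^{(k)}$ for $j=1,\ldots,n$. The quantity $\mathrm{Rate}_{k+1}$ is the ratio of the largest amplification factor (in absolute value) over the undesired eigenvalues to the smallest one over the desired eigenvalues. The maximum and minimum in its definition are taken over the indices $j\in\{1,\ldots,n\}$ satisfying the indicated inequality. $\delta_{ij}$ is the Kronecker delta. *)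

(* Defs.v *)
From HB Require Import structures.
From mathcomp Require Import all_boot all_order all_algebra.
From mathcomp Require Import reals ring.

Set Implicit Arguments.
Unset Strict Implicit.
Unset Printing Implicit Defensive.

Import Order.TTheory GRing.Theory Num.Theory.
Local Open Scope ring_scope.

(* Maximum and minimum of F over the indices satisfying P.  The seed of the   *)
(* iteration is itself one of the values F j with P j as soon as there is one *)
(* (see max_onP and min_onP); both are 0 when P is empty.                     *)
Definition max_on (R : realDomainType) (I : finType) (P : pred I) (F : I -> R)
    : R :=
  \big[Num.max/head 0 [seq F j | j in P]]_(j | P j) F j.

Definition min_on (R : realDomainType) (I : finType) (P : pred I) (F : I -> R)
    : R :=
  \big[Num.min/head 0 [seq F j | j in P]]_(j | P j) F j.

Lemma head_on (R : realDomainType) (I : finType) (P : pred I) (F : I -> R)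
    (i : I) :
  P i -> exists2 j, P j & head 0 [seq F j | j in P] = F j.
Proof.
move=> Pi; have : F i \in [seq F j | j in P] by apply: image_f.
case E : [seq F j | j in P] => [//|x s] _ /=.
have /imageP[j Pj ->] : x \in [seq F j | j in P] by rewrite E mem_head.
by exists j.
Qed.

Lemma max_onP (R : realDomainType) (I : finType) (P : pred I) (F : I -> R)
    (i : I) :
  P i -> (exists2 j, P j & max_on P F = F j) /\
         (forall j, P j -> F j <= max_on P F).
Proof.
move=> Pi; split; last by move=> j Pj; apply: le_bigmax_cond.
rewrite /max_on; apply: (big_ind (fun x => exists2 j, P j & x = F j)).
- exact: head_on Pi.
- move=> x y [j Pj ->] [k Pk ->].
  by case: leP => _; [exists k | exists j].
- by move=> j Pj; exists j.
Qed.

Lemma min_onP (R : realDomainType) (I : finType) (P : pred I) (F : I -> R)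
    (i : I) :
  P i -> (exists2 j, P j & min_on P F = F j) /\
         (forall j, P j -> min_on P F <= F j).
Proof.
move=> Pi; split; last by move=> j Pj; apply: bigmin_le_cond.
rewrite /min_on; apply: (big_ind (fun x => exists2 j, P j & x = F j)).
- exact: head_on Pi.
- move=> x y [j Pj ->] [k Pk ->].
  by case: leP => _; [exists j | exists k].
- by move=> j Pj; exists j.
Qed.

(* One Richardson step for (A - tau I) y = x, started from y = x. *)
Definition richardson_step (R : realType) (n : nat) (A : 'M[R]_n)
    (theta tau : R) (x : 'cV[R]_n) : 'cV[R]_n :=
  x - theta *: ((A - tau%:M) *m x - x).

(* Factor by which a step multiplies the component of x along an eigenvector  *)
(* of eigenvalue mu; richardson_step_coef is the resulting evolution of the   *)
(* coefficients.                                                              *)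
Definition amplification (R : realType) (theta tau mu : R) : R :=
  1 + theta * (1 + tau) - theta * mu.

Lemma richardson_step_coef (R : realType) (n : nat) (A : 'M[R]_n)
    (lambda : n.-tuple R) (phi : 'I_n -> 'cV[R]_n) (theta tau : R)
    (alpha : 'I_n -> R) :
  (forall j, A *m phi j = tnth lambda j *: phi j) ->
  richardson_step A theta tau (\sum_j alpha j *: phi j) =
  \sum_j (amplification theta tau (tnth lambda j) * alpha j) *: phi j.
Proof.
move=> eigA; rewrite /richardson_step mulmx_sumr -sumrB scaler_sumr -sumrB.
apply: eq_bigr => j _; rewrite /amplification.
rewrite -scalemxAr mulmxBl eigA mul_scalar_mx -scalerBl !scalerA -scalerBl.
by rewrite scalerA -scalerBl; congr (_ *: _); ring.
Qed.

(* The tuple lambda lists the eigenvalues from position 0: the l-th one is    *)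
(* lambda`_l.-1 and the (l+1)-st one is lambda`_l.                            *)
Definition Rate (R : realType) (n : nat) (lambda : n.-tuple R) (l : nat)
    (theta tau : R) : R :=
  max_on (fun j : 'I_n => lambda`_l <= tnth lambda j)
         (fun j => `|amplification theta tau (tnth lambda j)|) /
  min_on (fun j : 'I_n => tnth lambda j <= lambda`_l.-1)
         (fun j => `|amplification theta tau (tnth lambda j)|).

(* Main.v *)
(** The shift centres the amplification factor: it equals
    theta * (m - mu), where m is the midpoint of the undesired spectrum
    [lambda_{l+1}, lambda_n].  Its absolute value is thus largest, on the
    undesired eigenvalues, at the endpoint lambda_n, and, since the desired
    ones lie to the left of m, smallest on them at lambda_l. *)

Require Import Defs.
From mathcomp Require Import all_boot all_order all_algebra.
From mathcomp Require Import reals ring lra.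

Import Order.TTheory GRing.Theory Num.Theory.
Local Open Scope ring_scope.

Lemma max_on_eq (R : realDomainType) (I : finType) (P : pred I) (F : I -> R)
    (i : I) :
  P i -> (forall j, P j -> F j <= F i) -> max_on P F = F i.
Proof.
move=> Pi leF; have [[j Pj maxE] ubF] := max_onP F Pi.
by apply/le_anti; rewrite ubF // andbT maxE leF.
Qed.

Lemma min_on_eq (R : realDomainType) (I : finType) (P : pred I) (F : I -> R)
    (i : I) :
  P i -> (forall j, P j -> F i <= F j) -> min_on P F = F i.
Proof.
move=> Pi geF; have [[j Pj minE] lbF] := min_onP F Pi.
by apply/le_anti; rewrite lbF //= minE geF.
Qed.

Lemma amplification_midpoint_shift (R : realType) (theta a b mu : R) :
  theta != 0 ->
  amplification theta ((a + b) / 2 - 1 / theta - 1) mu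
  = theta * ((a + b) / 2 - mu).
Proof. by move=> theta_neq0; rewrite /amplification; field. Qed.

Theorem mainTheorem1 (R : realType) (n l : nat) (A : 'M[R]_n)
    (lambda : n.-tuple R) (phi : 'I_n -> 'cV[R]_n) (theta tau : R)
    (hl : (1 <= l)%N) (hln : (l < n)%N)
    (lambda_sorted : sorted <=%R lambda)
    (gap : lambda`_l.-1 < lambda`_l)
    (eigA : forall j : 'I_n, A *m phi j = tnth lambda j *: phi j)
    (orthonormal_phi :
      forall i j : 'I_n, ((phi i)^T *m phi j) 0 0 = (i == j)%:R)
    (theta_gt0 : 0 < theta) (theta_lt1 : theta < 1)
    (htau : tau = (lambda`_l + lambda`_n.-1) / 2 - 1 / theta - 1) :
  Rate lambda l theta tau =
    (lambda`_n.-1 - lambda`_l)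
      / (lambda`_n.-1 + lambda`_l - 2 * lambda`_l.-1) /\
  (lambda`_n.-1 - lambda`_l)
      / (lambda`_n.-1 + lambda`_l - 2 * lambda`_l.-1) =
    1 - 2 * ((lambda`_l - lambda`_l.-1)
               / (lambda`_n.-1 + lambda`_l - 2 * lambda`_l.-1)).
Proof.
have n_gt0 : (0 < n)%N by apply: leq_ltn_trans hln.
have last_ltn : (n.-1 < n)%N by rewrite prednK.
have pred_l_ltn : (l.-1 < n)%N by apply: leq_ltn_trans (leq_pred l) hln.
(* The bound [j < n] matters: past the end of the tuple, [nth] returns the default 0, which need not
   dominate the eigenvalues. *)
have lambda_le i j : (i <= j)%N -> (j < n)%N -> lambda`_i <= lambda`_j.
  move=> ij jn; apply: (sorted_leq_nth le_trans le_refl) => //.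
    by rewrite inE size_tuple (leq_ltn_trans ij).
  by rewrite inE size_tuple.
have lambda_le_last (j : 'I_n) : tnth lambda j <= lambda`_n.-1.
  by rewrite (tnth_nth 0) lambda_le // -ltnS prednK.
have le_l_last : lambda`_l <= lambda`_n.-1.
  by rewrite lambda_le // -ltnS prednK.
have tnth_Ordinal i (ltin : (i < n)%N) : tnth lambda (Ordinal ltin) = lambda`_i.
  by rewrite (tnth_nth 0).
rewrite {}htau /Rate.
rewrite (max_on_eq _ _ _ _ (Ordinal last_ltn)); first last.
- move=> j le_j; have le_j_last := lambda_le_last j.
  rewrite tnth_Ordinal !amplification_midpoint_shift ?gt_eqF // !normrM.
  (* The right-hand norm is the half-width of the undesired interval, so the two-sided bound says
     that [tnth lambda j] lies between its endpoints. *)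
  rewrite ler_pM2l ?normr_gt0 ?gt_eqF // [leRHS]ler0_norm ?ler_norml; lra.
- by rewrite tnth_Ordinal.
rewrite (min_on_eq _ _ _ _ (Ordinal pred_l_ltn)); first last.
- move=> j le_j.
  rewrite tnth_Ordinal !amplification_midpoint_shift ?gt_eqF // !normrM.
  (* By [gap], both eigenvalues lie below the midpoint: the norms drop and [le_j] remains. *)
  rewrite ler_pM2l ?normr_gt0 ?gt_eqF // !ger0_norm; lra.
- by rewrite tnth_Ordinal.
rewrite !tnth_Ordinal !amplification_midpoint_shift ?gt_eqF // !normrM.
(* The common factor [theta] cancels, so the rate depends on the spectrum alone. *)
rewrite -mulf_div divff ?normr_eq0 ?gt_eqF // mul1r.
rewrite [X in X / _]ler0_norm; last by lra.
rewrite ger0_norm; last by lra.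
(* The denominator is positive: it is the sum of the gaps from the last desired eigenvalue to the
   two endpoints. *)
by split; field; rewrite ?gt_eqF //; lra.
Qed.
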